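(* Let ${\bf a}=(a_1,\ldots,a_q),{\bf b}=(b_1,\ldots,b_q)\in\mathbb N^q$, put $A=\sum a_i$, $B=\sum b_i$, and let $n\ge\max(2,A+B)$ be an integer. Then $$\Phi_n\begin{pmatrix}2{\bf a}\\ 2{\bf b}\end{pmatrix}=\sum_{r_1,\ldots,r_q}\prod_{i=1}^q\frac{4^{r_i}a_i!\,b_i!}{(2r_i)!\,(a_i-r_i)!\,(b_i-r_i)!}\;\Phi_n\big(E(2R;\,A-R,\,B-R)\big),$$ where the sum is over all $r_i\in\{0,1,\ldots,\min(a_i,b_i)\}$ and $R=\sum r_i$.
   Context: Double factorial convention (non-standard): for an integer $m\ge0$, $m!!=(m-1)(m-3)(m-5)\cdots$, the product of the positive integers $\le m-1$ of the same parity as $m-1$ (empty product $=1$); thus $0!!=1!!=2!!=1$, $3!!=2$, $4!!=3$. Ordinary factorials are written $m!$. For a $2\times q$ matrix $\begin{pmatrix}{\bf a}\\{\bf b}\end{pmatrix}$ with nonnegative integer entries and $n\ge\max(2,q)$, $I_n\begin{pmatrix}{\bf a}\\{\bf b}\end{pmatrix}=\int_{O_n}\prod_{j}u_{1j}^{a_j}u_{2j}^{b_j}\,du$ (Haar probability measure), and $$\Phi_n\begin{pmatrix}{\bf a}\\ {\bf b}\end{pmatrix}=\frac{(\Sigma a_i+n-2)!!\,(\Sigma b_i+n-2)!!}{(n-2)!!\,(n-2)!!\,\prod a_i!!\,\prod b_i!!}\,I_n\begin{pmatrix}{\bf a}\\ {\bf b}\end{pmatrix}$$ (for even entries this equals $I_n/(I_{n-1}({\bf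 a})I_{n-1}({\bf b}))$, with $I_{n-1}$ the one-row integrals over $O_{n-1}$). For integers $s,x,y\ge0$, $E(s;x,y)$ denotes the $2\times(s+x+y)$ matrix $\begin{pmatrix}1^{s}&2^{x}&0^{y}\\1^{s}&0^{x}&2^{y}\end{pmatrix}$, where $k^x$ means $x$ consecutive entries equal to $k$: its first $s$ columns are $(1,1)^T$, the next $x$ are $(2,0)^T$, the last $y$ are $(0,2)^T$. *)

(* Defs.v *)
From HB Require Import structures.
From mathcomp Require Import all_boot all_order all_algebra.
Set Implicit Arguments. Unset Strict Implicit. Unset Printing Implicit Defensive.
Import Order.TTheory GRing.Theory Num.Theory.
Local Open Scope ring_scope.

(* Non-standard double factorial: m!! = (m-1)(m-3)...;  0!! = 1!! = 1. *)
Fixpoint dfact (m : nat) : nat :=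
  match m with
  | 0 => 1
  | 1 => 1
  | (k.+1 as m1).+1 => m1 * dfact k
  end%N.

Section Haar.
Variable R : rcfType.
Variable n : nat.

Definition orthogonal (g : 'M[R]_n) : Prop := g *m g^T = 1%:M.

Inductive polyfun : ('M[R]_n -> R) -> Prop :=
  | pf_const (c : R) : polyfun (fun _ => c)
  | pf_coord (i j : 'I_n) : polyfun (fun U => U i j)
  | pf_add f g : polyfun f -> polyfun g -> polyfun (fun U => f U + g U)
  | pf_mul f g : polyfun f -> polyfun g -> polyfun (fun U => f U * g U).

(* L is (the restriction to polynomial functions of) the integral against the
   Haar probability measure of O_n: a normalized linear functional on the
   polynomial functions on O_n, invariant under left and right translations
   by O_n. *)
Definition is_haar_integral (L : ('M[R]_n -> R) -> R) : Prop :=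
  (forall f g, polyfun f -> polyfun g ->
         L (fun U => f U + g U) = L f + L g) /\
      (forall (c : R) f, polyfun f -> L (fun U => c * f U) = c * L f) /\
      L (fun _ => 1) = 1 /\
      (forall f, polyfun f -> (forall U, orthogonal U -> f U = 0) -> L f = 0) /\
      (forall f g, polyfun f -> orthogonal g -> L (fun U => f (g *m U)) = L f) /\ (forall f g, polyfun f -> orthogonal g -> L (fun U => f (U *m g)) = L f).

(* The monomial  prod_j u_{1j}^{a_j} u_{2j}^{b_j}  (columns j = 0..size a - 1,
   rows 1,2 of the paper are rows 0,1 here). *)
Definition mono2 (a b : seq nat) (U : 'M[R]_n) : R :=
  \prod_(i < n) \prod_(j < n)
     U i j ^+ (if val i == 0%N then nth 0%N a j
               else if val i == 1%N then nth 0%N b j else 0%N).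

Definition Imom (L : ('M[R]_n -> R) -> R) (a b : seq nat) : R := L (mono2 a b).

Definition Phi (L : ('M[R]_n -> R) -> R) (a b : seq nat) : R :=
  (dfact (sumn a + n - 2) * dfact (sumn b + n - 2))%:R /
  (dfact (n - 2) * dfact (n - 2) *
   \prod_(x <- a) dfact x * \prod_(x <- b) dfact x)%:R * Imom L a b.

End Haar.

Definition Erow1 (s x y : nat) : seq nat := nseq s 1%N ++ nseq x 2%N ++ nseq y 0%N.
Definition Erow2 (s x y : nat) : seq nat := nseq s 1%N ++ nseq x 0%N ++ nseq y 2%N.

Definition dbl (s : seq nat) : seq nat := map (fun x => 2 * x)%N s.

(* Main.v *)
From mathcomp Require Import all_boot all_order all_algebra.
From mathcomp Require Import ring zify.
From Stdlib Require Import FunctionalExtensionality.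
(* After all_algebra, which has another [orthogonal]. *)
Require Import Defs.
Set Implicit Arguments. Unset Strict Implicit. Unset Printing Implicit Defensive.
Import Order.TTheory GRing.Theory Num.Theory.
Local Open Scope ring_scope.

(* For the first two rows u, v of a Haar orthogonal matrix, the mean of
   <u,x>^(2A) <v,y>^(2B) is invariant under a common rotation of x and y, hence
   a combination of the products |x|^(2(A-k)) |y|^(2(B-k)) <x,y>^(2k) with
   coefficients c_k.  Comparing the coefficients of the monomials in x and y
   expresses every moment through the c_k, the k-th one being weighted by a
   coefficient of a product over the columns.  For E(2k; A-k, B-k) only c_k
   survives, so c_k is read off from that moment; substituting it back in the
   formula for the moment (2a; 2b) gives the expansion. *)

(** * Inner products and reflections *)

Section Reflections.
Variables (R : rcfType) (n : nat).
Implicit Types (x y z w : 'cV[R]_n) (g : 'M[R]_n).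

Definition dot x y : R := \sum_j x j 0 * y j 0.

Lemma mul_tr_dot x y : x^T *m y = (dot x y)%:M.
Proof.
apply/matrixP=> i j; rewrite !ord1 !mxE /= mulr1n.
by apply: eq_bigr => k _; rewrite mxE.
Qed.

Lemma dotC x y : dot x y = dot y x.
Proof. by apply: eq_bigr => k _; rewrite mulrC. Qed.

Lemma dotDl x y z : dot (x + y) z = dot x z + dot y z.
Proof. by rewrite -big_split; apply: eq_bigr => k _; rewrite mxE mulrDl. Qed.

Lemma dotZl c x z : dot (c *: x) z = c * dot x z.
Proof. by rewrite mulr_sumr; apply: eq_bigr => k _; rewrite mxE mulrA. Qed.

Lemma dotNl x z : dot (- x) z = - dot x z.
Proof. by rewrite -scaleN1r dotZl mulN1r. Qed.

Lemma dotDr x y z : dot z (x + y) = dot z x + dot z y.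
Proof. by rewrite dotC dotDl !(dotC z). Qed.

Lemma dotZr c x z : dot z (c *: x) = c * dot z x.
Proof. by rewrite dotC dotZl (dotC z). Qed.

Lemma dotNr x z : dot z (- x) = - dot z x.
Proof. by rewrite dotC dotNl (dotC z). Qed.

Definition dotE := (dotDl, dotDr, dotZl, dotZr, dotNl, dotNr).

Lemma dot_delta x (i : 'I_n) : dot (delta_mx i 0) x = x i 0.
Proof.
rewrite /dot (bigD1 i) //= big1 ?addr0 => [|j /negPf ji].
  by rewrite mxE !eqxx mul1r.
by rewrite mxE ji mul0r.
Qed.

Lemma dot_ge0 x : 0 <= dot x x.
Proof. by apply: sumr_ge0 => j _; rewrite -expr2 sqr_ge0. Qed.

Lemma dot_eq0 x : dot x x = 0 -> x = 0.
Proof.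
move=> /eqP; rewrite psumr_eq0 => [/allP h|j _]; last by rewrite -expr2 sqr_ge0.
apply/matrixP => i j; rewrite ord1 mxE.
by have := h i (mem_index_enum i); rewrite -expr2 sqrf_eq0 => /eqP.
Qed.

Lemma dot_orthogonal g x y : orthogonal g -> dot (g *m x) (g *m y) = dot x y.
Proof.
rewrite /orthogonal => /mulmx1C gg.
suff : (dot (g *m x) (g *m y))%:M = (dot x y)%:M :> 'M_1.
  by move/matrixP/(_ 0 0); rewrite !mxE.
by rewrite -!mul_tr_dot trmx_mul mulmxA -(mulmxA _ _ g) gg mulmx1.
Qed.

(** The Householder reflection in the hyperplane orthogonal to [x - y]. Equal norms make [x] and [y]
    mirror images in it. *)
Lemma exists_reflection x y : dot x x = dot y y ->
  exists g, [/\ orthogonal g, g *m x = y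
              & forall z, dot (x - y) z = 0 -> g *m z = z].
Proof.
move=> xy; set w := x - y; set c := 2 / dot w w.
(* This is what makes [g] an involution. If [w] is 0, then [c] is 0 as well, since the inverse of 0
   is 0, and [g] is the identity. *)
have cw : c * (c * dot w w - 2) = 0.
  have [w0|w0] := eqVneq (dot w w) 0; first by rewrite /c w0 invr0 mulr0 mul0r.
  by rewrite /c divfK // subrr mulr0.
pose g : 'M_n := 1%:M - c *: (w *m w^T).
have gE z : g *m z = z - (c * dot w z) *: w.
  rewrite mulmxBl mul1mx -scalemxAl -mulmxA mul_tr_dot.
  by rewrite mul_mx_scalar scalerA.
have gT : g^T = g.
  by rewrite /g linearB /= trmx1 linearZ /= trmx_mul trmxK.
exists g; split.
- rewrite /orthogonal gT {2}/g mulmxBr mulmx1 -scalemxAr mulmxA gE.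
  rewrite mulmxBl scalerBr -scalemxAl scalerA /g.
  rewrite -addrA -opprD -scalerBl -scalerDl.
  have -> : c + (c - c * (c * dot w w)) = - (c * (c * dot w w - 2)) by ring.
  by rewrite cw oppr0 scale0r subr0.
- rewrite gE.
  have ww : dot w w = 2 * dot w x.
    by rewrite /w !dotE -xy (dotC y x); ring.
  have [w0|w0] := eqVneq (dot w w) 0.
    have /subr0_eq xy0 := dot_eq0 w0.
    by rewrite /c w0 invr0 mulr0 mul0r scale0r subr0.
  have -> : c * dot w x = 1.
    have w1 : dot w x != 0 by apply: contra_neq w0 => h; rewrite ww h mulr0.
    by rewrite /c ww; field.
  by rewrite scale1r /w opprB addrCA subrr addr0.
- by move=> z wz; rewrite gE wz mulr0 scale0r subr0.
Qed.

Lemma orthogonalM g h : orthogonal g -> orthogonal h -> orthogonal (g *m h).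
Proof.
by rewrite /orthogonal trmx_mul mulmxA -(mulmxA g) => gg ->; rewrite mulmx1.
Qed.

(** One reflection takes [x] to the axis of [i]; a second one, fixing that axis, takes the image of
    [y] into the plane of [i] and [j]. The sign of [be] is free, and both choices are recorded so
    that odd powers of [be] can be cancelled later. *)
Lemma exists_planar_position (i j : 'I_n) x y : i != j ->
  exists t al be : R, [/\ t ^+ 2 = dot x x, t * al = dot x y,
    al ^+ 2 + be ^+ 2 = dot y y,
    exists g, [/\ orthogonal g, g *m x = t *: delta_mx i 0
                & g *m y = al *: delta_mx i 0 + be *: delta_mx j 0]
  & exists g, [/\ orthogonal g, g *m x = t *: delta_mx i 0
                & g *m y = al *: delta_mx i 0 - be *: delta_mx j 0]].
Proof.
move=> ij; pose e k : 'cV[R]_n := delta_mx k 0.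
have dotee k l : dot (e k) (e l) = (k == l)%:R by rewrite dot_delta mxE eqxx andbT.
set t := Num.sqrt (dot x x).
have t2 : t ^+ 2 = dot x x by rewrite sqr_sqrtr ?dot_ge0.
have [g [go gx _]] : exists g, [/\ orthogonal g, g *m x = t *: e i
    & forall z, dot (x - t *: e i) z = 0 -> g *m z = z].
  by apply: exists_reflection; rewrite !dotE dotee eqxx mulr1 -expr2 t2.
set y' := g *m y; set al := y' i 0.
have le : 0 <= dot y' y' - al ^+ 2.
  rewrite /dot (bigD1 i) //= expr2 addrAC subrr add0r.
  by apply: sumr_ge0 => k _; rewrite -expr2 sqr_ge0.
set be := Num.sqrt (dot y' y' - al ^+ 2).
have be2 : be ^+ 2 = dot y' y' - al ^+ 2 by rewrite sqr_sqrtr.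
(* The vector [y'] and its target share the coordinate [al] on axis [i], so their difference is
   orthogonal to [e i] and the reflection fixes [t *: e i]. *)
have second s : s ^+ 2 = 1 -> exists g, [/\ orthogonal g, g *m x = t *: e i
    & g *m y = al *: e i + (s * be) *: e j].
  move=> s2; have [|h [ho hy hfix]] :=
      @exists_reflection y' (al *: e i + (s * be) *: e j).
    rewrite !dotE !dotee !eqxx ?(eq_sym j i) (negPf ij) /=.
    by transitivity (al ^+ 2 + s ^+ 2 * be ^+ 2); [rewrite s2 be2; ring|ring].
  exists (h *m g); split; first exact: orthogonalM.
    rewrite -mulmxA gx -scalemxAr hfix // !dotE !dotee eqxx ?(eq_sym j i) (negPf ij) /=.
    by rewrite dotC dot_delta -/al; ring.
  by rewrite -mulmxA hy.
exists t, al, be; split => //.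
- by rewrite -(dot_orthogonal x y go) gx dotZl dot_delta.
- by rewrite be2 -(dot_orthogonal y y go) addrCA subrr addr0.
- by have := second 1; rewrite expr1n mul1r => /(_ erefl).
- have [|h [h1 h2 h3]] := second (-1); first by rewrite sqrrN expr1n.
  by exists h; split; rewrite // h3 mulN1r scaleNr.
Qed.

End Reflections.

(** * Means of products of powers of linear forms *)

Section Polyfun.
Variables (R : rcfType) (n : nat).

Lemma polyfun_eq (f g : 'M[R]_n -> R) : f =1 g -> polyfun f -> polyfun g.
Proof. by move=> /functional_extensionality ->. Qed.

Lemma polyfun_sum I (r : seq I) (P : pred I) (F : I -> 'M[R]_n -> R) :
  (forall i, polyfun (F i)) -> polyfun (fun U => \sum_(i <- r | P i) F i U).
Proof.
move=> pF; elim: r => [|i r ih].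
  by apply: polyfun_eq (pf_const _ _) => U; rewrite big_nil.
case Pi : (P i); last by apply: polyfun_eq ih => U; rewrite big_cons Pi.
by apply: polyfun_eq (pf_add (pF i) ih) => U; rewrite big_cons Pi.
Qed.

Lemma polyfun_prod I (r : seq I) (P : pred I) (F : I -> 'M[R]_n -> R) :
  (forall i, polyfun (F i)) -> polyfun (fun U => \prod_(i <- r | P i) F i U).
Proof.
move=> pF; elim: r => [|i r ih].
  by apply: polyfun_eq (pf_const _ _) => U; rewrite big_nil.
case Pi : (P i); last by apply: polyfun_eq ih => U; rewrite big_cons Pi.
by apply: polyfun_eq (pf_mul (pF i) ih) => U; rewrite big_cons Pi.
Qed.

Lemma polyfun_exp (f : 'M[R]_n -> R) k : polyfun f -> polyfun (fun U => f U ^+ k).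
Proof.
move=> pf; elim: k => [|k ih]; first exact: pf_const.
by apply: polyfun_eq (pf_mul pf ih) => U; rewrite exprS.
Qed.

Lemma polyfun_mulmx_coord (x : 'cV[R]_n) i : polyfun (fun U => (U *m x) i 0).
Proof.
apply: (@polyfun_eq (fun U => \sum_j U i j * x j 0)) => [U|]; first by rewrite mxE.
by apply: polyfun_sum => j; apply: pf_mul; [apply: pf_coord | apply: pf_const].
Qed.

End Polyfun.

Section Moments.
Variables (R : rcfType) (n : nat) (L : ('M[R]_n -> R) -> R).
Hypothesis HL : is_haar_integral L.

Lemma eq_haar f g : f =1 g -> L f = L g.
Proof. by move=> /functional_extensionality ->. Qed.

Lemma haarZ c f : polyfun f -> L (fun U => c * f U) = c * L f.
Proof. by case: HL => _ [H _]; apply: H. Qed.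

Lemma haar_sum I (r : seq I) (P : pred I) (F : I -> 'M[R]_n -> R) :
  (forall i, polyfun (F i)) ->
  L (fun U => \sum_(i <- r | P i) F i U) = \sum_(i <- r | P i) L (F i).
Proof.
case: HL => HD _ pF; elim: r => [|i r ih].
  (* The zero function is treated as 0 times the constant 1. *)
  rewrite big_nil -[RHS](mul0r (L (fun _ => 1))) -haarZ; last exact: pf_const.
  by apply: eq_haar => U; rewrite big_nil mul0r.
rewrite big_cons; case Pi : (P i); last first.
  by rewrite -ih; apply: eq_haar => U; rewrite big_cons Pi.
rewrite -ih -HD //; last exact: polyfun_sum.
by apply: eq_haar => U; rewrite big_cons Pi.
Qed.

(** As a polynomial in the coordinates of [x] and [y], this is a generating function of the moments
    of degrees [m] and [l] in the rows [i0] and [i1]. *)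
Definition powmean (i0 i1 : 'I_n) m l (x y : 'cV[R]_n) : R :=
  L (fun U => (U *m x) i0 0 ^+ m * (U *m y) i1 0 ^+ l).

Lemma polyfun_powmean i0 i1 m l (x y : 'cV[R]_n) :
  polyfun (fun U => (U *m x) i0 0 ^+ m * (U *m y) i1 0 ^+ l).
Proof. by apply: pf_mul; apply: polyfun_exp; apply: polyfun_mulmx_coord. Qed.

Lemma powmean_orthogonal i0 i1 m l (g : 'M[R]_n) x y : orthogonal g ->
  powmean i0 i1 m l (g *m x) (g *m y) = powmean i0 i1 m l x y.
Proof.
case: HL => _ [_ [_ [_ [_ H]]]] go.
rewrite /powmean -(H _ g (polyfun_powmean i0 i1 m l x y) go).
by apply: eq_haar => U; rewrite !mulmxA.
Qed.

Lemma powmeanC i0 i1 m l x y : powmean i0 i1 m l x y = powmean i1 i0 l m y x.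
Proof. by apply: eq_haar => U; rewrite mulrC. Qed.

(** Binomial expansion in the second factor. What matters is that the constants [K j] do not depend
    on [t], [al] and [be]. *)
Lemma powmean_planar i0 i1 m l (j0 j1 : 'I_n) :
  exists K : nat -> R, forall t al be : R,
  powmean i0 i1 m l (t *: delta_mx j0 0) (al *: delta_mx j0 0 + be *: delta_mx j1 0)
   = \sum_(j < l.+1) K j * (t ^+ m * al ^+ (l - j) * be ^+ j).
Proof.
pose f (j : nat) (U : 'M[R]_n) := U i0 j0 ^+ m * U i1 j0 ^+ (l - j) * U i1 j1 ^+ j.
have pf j : polyfun (f j).
  by apply: pf_mul; [apply: pf_mul|]; apply: polyfun_exp; apply: pf_coord.
exists (fun j => L (f j) *+ 'C(l, j)) => t al be.
transitivity (L (fun U => \sum_(j < l.+1)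
    (t ^+ m * al ^+ (l - j) * be ^+ j *+ 'C(l, j)) * f j U)).
  apply: eq_haar => U.
  have E c i j : (c *: (U *m delta_mx j 0) : 'cV_n) i 0 = c * U i j.
    by rewrite mxE -colE mxE.
  rewrite mulmxDr -!scalemxAr [X in _ * X ^+ _]mxE !E exprMn exprDn mulr_sumr.
  apply: eq_bigr => j _.
  by rewrite /f !exprMn mulrnAr mulrnAl; congr (_ *+ _); ring.
rewrite haar_sum; last by move=> j; apply: pf_mul => //; apply: pf_const.
by apply: eq_bigr => j _; rewrite haarZ // mulrC mulrnAl mulrnAr.
Qed.

(** Meant for [Y] the square of the inner product and [W] the product of the two squared norms, so
    that [W - Y] is the square of [t * be]. *)
Lemma homogeneous_sub_pow (B : nat) : exists c : nat -> nat -> R,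
  forall i (W Y : R), (i <= B)%N ->
  Y ^+ (B - i) * (W - Y) ^+ i = \sum_(k < B.+1) c i k * (Y ^+ k * W ^+ (B - k)).
Proof.
(* The [h]-th binomial term has degree [B - i + h] in [Y]; the indicator sends it to that [k]. *)
exists (fun i k => \sum_(h < i.+1) ((k == B - i + h)%N%:R * ((-1) ^+ h *+ 'C(i, h)))).
move=> i W Y iB; rewrite exprDn mulr_sumr.
under [RHS]eq_bigr do rewrite mulr_suml.
rewrite exchange_big; apply: eq_bigr => h _ /=.
have hB : (B - i + h < B.+1)%N.
  by rewrite ltnS -{2}(subnK iB) leq_add2l -ltnS.
rewrite (bigD1 (Ordinal hB)) //= eqxx big1 ?addr0 => [|k kh].
  rewrite -[(- Y)]mulN1r exprMn exprD.
  rewrite subnDA subKn // !mulrnAr !mulrnAl; congr (_ *+ _); rewrite mulr1n; ring.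
by move: kh; rewrite -val_eqE /= => /negPf ->; rewrite !mul0r.
Qed.

Lemma sum_even_terms (f : nat -> R) B :
  \sum_(j < (2 * B).+1) (1 + (-1) ^+ j) * f j = 2 * \sum_(i < B.+1) f (2 * i)%N.
Proof.
elim: B => [|B ih]; first by rewrite !big_ord1 expr0.
rewrite big_ord_recr [in RHS]big_ord_recr /= mulrDr -ih.
have -> : (2 * B.+1 = (2 * B).+2)%N by rewrite mulnS.
rewrite big_ord_recr /= -addrA; congr (_ + _).
by rewrite !exprS exprM sqrrN !expr1n; ring.
Qed.

(* Rotate x to the axis of j0 and y into the plane of j0, j1; flipping the sign
   of the j1-coordinate kills the odd powers of it, so only polynomials in the
   inner products remain. *)
Lemma powmean_invariant_le i0 i1 A B (j0 j1 : 'I_n) : j0 != j1 -> (B <= A)%N ->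
  exists c : nat -> R, forall x y, powmean i0 i1 (2 * A) (2 * B) x y =
   \sum_(k < B.+1) c k *
     (dot x x ^+ (A - k) * dot y y ^+ (B - k) * dot x y ^+ (2 * k)).
Proof.
move=> j01 BA.
have [K HK] := powmean_planar i0 i1 (2 * A) (2 * B) j0 j1.
have [c Hc] := homogeneous_sub_pow B.
exists (fun k => \sum_(i < B.+1) K (2 * i)%N * c i k) => x y.
have [t [al [be [t2 tal albe [g [go gx gy]] [h [ho hx hy]]]]]] :=
  exists_planar_position x y j01.
set G := powmean _ _ _ _.
(* Adding the values at the two planar positions joins the powers of [be] and [- be] into the weight
   [1 + (-1) ^+ j]. *)
have two : 2 * G x y = \sum_(j < (2 * B).+1)
    (1 + (-1) ^+ j) * (K j * (t ^+ (2 * A) * al ^+ (2 * B - j) * be ^+ j)).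
  have -> : 2 * G x y = G x y + G x y by ring.
  rewrite -{1}[G x y](powmean_orthogonal i0 i1 _ _ x y go) gx gy HK.
  rewrite -[G x y](powmean_orthogonal i0 i1 _ _ x y ho) hx hy -scaleNr HK.
  rewrite -big_split.
  apply: eq_bigr => j _ /=; rewrite -[- be]mulN1r exprMn; ring.
rewrite (sum_even_terms (fun j =>
  K j * (t ^+ (2 * A) * al ^+ (2 * B - j) * be ^+ j))) in two.
have -> : G x y = \sum_(i < B.+1)
    K (2 * i)%N * (t ^+ (2 * A) * al ^+ (2 * B - 2 * i) * be ^+ (2 * i)).
  by apply: (@mulfI _ 2); rewrite ?pnatr_eq0.
under [RHS]eq_bigr do rewrite mulr_suml.
rewrite exchange_big; apply: eq_bigr => i _ /=.
have iB : (i <= B)%N by rewrite -ltnS.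
(* Since [B <= A], there is a factor [t ^+ 2] for each [al ^+ 2] and each [be ^+ 2], so everything
   becomes polynomial in the inner products without dividing by [t]. *)
have -> : t ^+ (2 * A) * al ^+ (2 * B - 2 * i) * be ^+ (2 * i) =
    t ^+ 2 ^+ (A - B) * (((t * al) ^+ 2) ^+ (B - i)
      * (t ^+ 2 * (al ^+ 2 + be ^+ 2) - (t * al) ^+ 2) ^+ i).
  have -> : t ^+ 2 * (al ^+ 2 + be ^+ 2) - (t * al) ^+ 2 = t ^+ 2 * be ^+ 2 by ring.
  have -> : t ^+ (2 * A) = t ^+ 2 ^+ (A - B) * (t ^+ 2 ^+ (B - i) * t ^+ 2 ^+ i).
    by rewrite -!exprD subnK // subnK // exprM.
  by rewrite -mulnBr !(exprM _ 2) !expr2 !exprMn; ring.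
rewrite Hc // !mulr_sumr; apply: eq_bigr => k _.
have kB : (k <= B)%N by rewrite -ltnS.
have -> : (A - k = A - B + (B - k))%N by rewrite addnBA // subnK.
by rewrite t2 tal albe !(exprM _ 2) !expr2 !exprMn exprD; ring.
Qed.

(** The case [A < B] follows by exchanging the two rows together with [x] and [y]. *)
Lemma powmean_invariant i0 i1 A B : (2 <= n)%N ->
  exists c : nat -> R, forall x y, powmean i0 i1 (2 * A) (2 * B) x y =
   \sum_(k < (minn A B).+1) c k *
     (dot x x ^+ (A - k) * dot y y ^+ (B - k) * dot x y ^+ (2 * k)).
Proof.
move=> n2; have n0 : (0 < n)%N by apply: ltnW.
have ne : Ordinal n0 != Ordinal n2 by [].
have [BA|/ltnW AB] := leqP B A.
  have [c Hc] := powmean_invariant_le i0 i1 ne BA; exists c; exact: Hc.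
have [c Hc] := powmean_invariant_le i1 i0 ne AB; exists c => x y.
rewrite powmeanC Hc; apply: eq_bigr => k _.
by rewrite (dotC y x) (mulrC (dot y y ^+ _)).
Qed.

End Moments.

(** * Multinomial expansions and comparison of coefficients *)

Section Coefficients.
Variable R : numFieldType.

Lemma natr_fact_neq0 k : k`!%:R != 0 :> R.
Proof. by rewrite pnatr_eq0 -lt0n fact_gt0. Qed.

(** The binomial theorem for divided powers: exponential series multiply by adding their arguments.
    It is the induction step of [multinomial_expansion]. *)
Lemma exprD_divided (x y : R) m : (x + y) ^+ m / m`!%:R =
  \sum_(i < m.+1) x ^+ i / i`!%:R * (y ^+ (m - i) / (m - i)`!%:R).
Proof.
rewrite addrC exprDn mulr_suml; apply: eq_bigr => i _.
have im : (i <= m)%N by rewrite -ltnS.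
rewrite -mulr_natr -(bin_fact im) !natrM.
have bin0 : 'C(m, i)%:R != 0 :> R by rewrite pnatr_eq0 -lt0n bin_gt0.
by field; rewrite bin0 !natr_fact_neq0.
Qed.

(* The sum over s is the coefficient of X^m in the product of the truncated
   exponentials of the z i X. *)
Lemma multinomial_expansion (I : finType) (z : I -> R) d m : (m < d)%N ->
  (\sum_i z i) ^+ m = m`!%:R *
  \sum_(s : {ffun I -> 'I_d} | (\sum_i s i == m)%N) \prod_i (z i ^+ s i / (s i)`!%:R).
Proof.
move=> md; pose e (x : R) := \poly_(k < d) (x ^+ k / k`!%:R).
have E : forall k, (k < d)%N ->
    (\prod_i e (z i))`_k = (\sum_i z i) ^+ k / k`!%:R.
  apply: (big_ind2 (fun (p : {poly R}) x =>
    forall k, (k < d)%N -> p`_k = x ^+ k / k`!%:R)).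
  - by move=> k _; rewrite coef1 expr0n; case: k => //= [|k]; rewrite ?divr1 ?mul0r.
  - move=> p x q y Hp Hq k kd; rewrite coefM exprD_divided.
    apply: eq_bigr => i _; rewrite Hp ?Hq //.
      exact: leq_ltn_trans (leq_subr _ _) kd.
    by apply: leq_trans kd; rewrite ltn_ord.
  - by move=> i _ k kd; rewrite coef_poly kd.
apply: (@mulIf _ (m`!%:R^-1)); first by rewrite invr_neq0 ?natr_fact_neq0.
rewrite -E // mulrAC mulfV ?natr_fact_neq0 // mul1r.
under eq_bigr => i _ do rewrite /e poly_def.
rewrite bigA_distr_bigA coef_sum [RHS]big_mkcond; apply: eq_bigr => s _ /=.
have -> : \prod_i (z i ^+ s i / (s i)`!%:R *: 'X^(s i)) =
   (\prod_i (z i ^+ s i / (s i)`!%:R)) *: 'X^(\sum_i s i)%N :> {poly R}.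
  by rewrite scaler_prod prodrXr.
by rewrite coefZ coefXn eq_sym; case: eqP => _; rewrite ?mulr1 ?mulr0.
Qed.

(** The three multi-indices are merged into one function with values in triples, so that each
    summand is a single product over the columns. *)
Lemma multinomial_expansion3 (I : finType) (u v w : I -> R) d a b c :
  (a < d)%N -> (b < d)%N -> (c < d)%N ->
  (\sum_i u i) ^+ a * (\sum_i v i) ^+ b * (\sum_i w i) ^+ c =
  (a`! * b`! * c`!)%:R *
  \sum_(f : {ffun I -> 'I_d * 'I_d * 'I_d} | [&& (\sum_i (f i).1.1 == a)%N,
      (\sum_i (f i).1.2 == b)%N & (\sum_i (f i).2 == c)%N])
    \prod_i (((f i).1.1`! * (f i).1.2`! * (f i).2`!)%:R^-1 *
       (u i ^+ (f i).1.1 * v i ^+ (f i).1.2 * w i ^+ (f i).2)).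
Proof.
move=> ad bd cd; rewrite (multinomial_expansion u ad) (multinomial_expansion v bd).
rewrite (multinomial_expansion w cd).
have collect (x y z s t r : R) : x * s * (y * t) * (z * r) = x * y * z * (s * t * r).
  by ring.
rewrite !natrM collect; congr (_ * _).
rewrite big_distrlr /= pair_big /= big_distrlr /= pair_big /=.
pose h (p : {ffun I -> 'I_d} * {ffun I -> 'I_d} * {ffun I -> 'I_d}) :
  {ffun I -> 'I_d * 'I_d * 'I_d} := [ffun i => (p.1.1 i, p.1.2 i, p.2 i)].
rewrite [RHS](reindex h); last first.
  exists (fun f : {ffun I -> 'I_d * 'I_d * 'I_d} =>
   ([ffun i => (f i).1.1] : {ffun I -> 'I_d},
    [ffun i => (f i).1.2] : {ffun I -> 'I_d}, [ffun i => (f i).2] : {ffun I -> 'I_d})).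
    move=> [[p q] r] _; rewrite /h /=; congr (_, _, _).
    - by apply/ffunP => i; rewrite !ffunE.
    - by apply/ffunP => i; rewrite !ffunE.
    - by apply/ffunP => i; rewrite !ffunE.
  by move=> f _; apply/ffunP => i; rewrite !ffunE /=; case: (f i) => [[? ?] ?].
apply: eq_big => [[[p q] r]|[[p q] r] _] /=.
  rewrite /h -andbA; congr (_ && _); last (congr (_ && _)).
  - by congr (_ == _); apply: eq_bigr => i _; rewrite ffunE.
  - by congr (_ == _); apply: eq_bigr => i _; rewrite ffunE.
  - by congr (_ == _); apply: eq_bigr => i _; rewrite ffunE.
rewrite -!big_split; apply: eq_bigr => i _ /=; rewrite ffunE /= !natrM.
by field; rewrite !natr_fact_neq0.
Qed.

(** The residue modulo [D] gives the lowest digit, and the quotient is handled by induction. *)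
Lemma base_digits_inj D N (f g : nat -> nat) :
  (forall i, (i < N)%N -> (f i < D)%N /\ (g i < D)%N) ->
  (\sum_(i < N) f i * D ^ i = \sum_(i < N) g i * D ^ i)%N ->
  forall i, (i < N)%N -> f i = g i.
Proof.
elim: N f g => [//|N ih] f g H E.
have [f0 g0] := H 0%N isT.
have D0 : (0 < D)%N by case: (D) f0.
have split_low (h : nat -> nat) : (\sum_(i < N.+1) h i * D ^ i =
    (\sum_(i < N) h i.+1 * D ^ i) * D + h 0)%N.
  rewrite big_ord_recl /= expn0 muln1 addnC big_distrl; congr (_ + _)%N.
  by apply: eq_bigr => i _; rewrite /= /bump /= add1n expnS mulnA mulnAC.
rewrite !split_low in E.
have E0 : f 0%N = g 0%N.
  by have := congr1 (modn^~ D) E; rewrite /= !modnMDl !modn_small.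
move: E; rewrite E0 => /addIn /eqP; rewrite eqn_pmul2r // => /eqP E1.
case=> [//|i]; rewrite ltnS => iN.
by apply: (ih (f \o succn) (g \o succn)) => // k kN; apply: H.
Qed.

(** In characteristic 0 the natural numbers supply more roots of [p - q] than its degree allows. *)
Lemma poly_ext (p q : {poly R}) : (forall t, p.[t] = q.[t]) -> p = q.
Proof.
move=> pq; apply: subr0_eq.
apply: (@roots_geq_poly_eq0 _ _ [seq k%:R | k <- iota 0 (size (p - q))]).
- by apply/allP => t _; rewrite /root !hornerE pq subrr.
- by rewrite map_inj_uniq ?iota_uniq // => i j /eqP; rewrite eqr_nat => /eqP.
- by rewrite size_map size_iota.
Qed.

(* Kronecker's substitution x_i = t^(D^i) reduces this to one variable. *)
Lemma coefficients_eq (I J K : finType) (P : pred J) (Q : pred K)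
    (e : J -> I -> nat) (e' : K -> I -> nat) (c : J -> R) (c' : K -> R) :
  (forall x : I -> R, \sum_(j | P j) c j * \prod_i x i ^+ e j i =
                      \sum_(k | Q k) c' k * \prod_i x i ^+ e' k i) ->
  forall m : I -> nat, \sum_(j | P j && [forall i, e j i == m i]) c j =
                       \sum_(k | Q k && [forall i, e' k i == m i]) c' k.
Proof.
move=> H m.
(* A base larger than every exponent that occurs. *)
pose D := (\sum_j \sum_i e j i + \sum_k \sum_i e' k i + \sum_i m i).+1%N.
have eD j i : (e j i < D)%N.
  by rewrite ltnS /D (bigD1 j) //= (bigD1 i) //= -!addnA leq_addr.
have e'D j i : (e' j i < D)%N.
  by rewrite ltnS /D addnAC addnC (bigD1 j) //= (bigD1 i) //= -!addnA leq_addr.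
have mD i : (m i < D)%N.
  by rewrite ltnS /D addnC (bigD1 i) //= -!addnA leq_addr.
pose phi (f : I -> nat) := (\sum_(i < #|I|) f (enum_val i) * D ^ i)%N.
have phi_inj f : (forall i, f i < D)%N -> (phi f == phi m) = [forall k, f k == m k].
  move=> fD; apply/eqP/forallP => [E u|E]; last first.
    by apply: eq_bigr => i _; rewrite (eqP (E _)).
  (* [base_digits_inj] speaks of digits indexed by [nat]; [tot] transports [f] along the enumeration
     of [I], with default 0 outside its range. *)
  pose tot (f : I -> nat) k :=
    if insub k is Some i then f (enum_val (i : 'I_#|I|)) else 0%N.
  have totE f' (i : 'I_#|I|) : tot f' i = f' (enum_val i).
    by rewrite /tot insubT // => ?; congr (f' (enum_val _)); apply: val_inj.
  have := @base_digits_inj D #|I| (tot f) (tot m).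
  move=> /(_ _ _ _ (ltn_ord (enum_rank u))); rewrite !totE !enum_rankK => -> //.
    move=> k kI; rewrite -[k]/(val (Ordinal kI)) !totE; split; [exact: fD | exact: mD].
  under eq_bigr do rewrite totE.
  by under [RHS]eq_bigr do rewrite totE.
have kron f t : \prod_i (t ^+ (D ^ enum_rank i)) ^+ f i = t ^+ phi f :> R.
  rewrite /phi -prodrXr [LHS](reindex (enum_val : 'I_#|I| -> I)) /=; last first.
    by apply: onW_bij; apply: enum_val_bij.
  by apply: eq_bigr => i _; rewrite enum_valK -exprM mulnC.
have polyE : \sum_(j | P j) c j *: 'X^(phi (e j)) =
    \sum_(k | Q k) c' k *: 'X^(phi (e' k)).
  apply: poly_ext => t; rewrite !horner_sum.
  have := H (fun i => t ^+ (D ^ enum_rank i)).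
  under eq_bigr do rewrite kron.
  under [in RHS]eq_bigr do rewrite kron.
  move=> E; under eq_bigr do rewrite hornerZ hornerXn.
  by rewrite E; apply: eq_bigr => k _; rewrite hornerZ hornerXn.
have := congr1 (fun p : {poly R} => p`_(phi m)) polyE; rewrite /= !coef_sum.
rewrite !big_mkcondr /=.
under eq_bigr => j _ do rewrite coefZ coefXn eq_sym phi_inj //.
under [in RHS]eq_bigr => j _ do rewrite coefZ coefXn eq_sym phi_inj //.
move=> E; etransitivity; last etransitivity; [|exact: E|].
  by apply: eq_bigr => j _; case: ifP => _; rewrite ?mulr1 ?mulr0.
by apply: eq_bigr => j _; case: ifP => _; rewrite ?mulr1 ?mulr0.
Qed.

End Coefficients.

(** * Moments as coefficients of products over the columns *)

(** A triple (p, q, r) records the exponents that one column, with coordinates x and y, receives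
    from the two squared norms and from the inner product: x^2, y^2 and xy to the powers p, q and r
    must give x^[al] y^[be]. The variable marks r, and [d] only makes the index type finite. *)
Definition colpoly (R : numFieldType) d al be : {poly R} :=
  \sum_(t : 'I_d * 'I_d * 'I_d | (2 * t.1.1 + t.2 == al)%N && (2 * t.1.2 + t.2 == be)%N)
    (t.1.1`! * t.1.2`! * t.2`!)%:R^-1 *: 'X^(t.2).

Lemma coef_prod_colpoly (R : numFieldType) (I : finType) d (al be : I -> nat) m :
  (\prod_i colpoly R d (al i) (be i))`_m =
  \sum_(f : {ffun I -> 'I_d * 'I_d * 'I_d} |
     [forall i, (2 * (f i).1.1 + (f i).2 == al i)%N
       && (2 * (f i).1.2 + (f i).2 == be i)%N]
     && (\sum_i (f i).2 == m)%N)
    \prod_i ((f i).1.1`! * (f i).1.2`! * (f i).2`!)%:R^-1.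
Proof.
rewrite /colpoly bigA_distr_big_dep coef_sum [RHS]big_mkcondr.
apply: eq_big => [f|f _]; first by apply/familyP/forallP.
rewrite scaler_prod prodrXr coefZ coefXn eq_sym.
by case: eqP => _; rewrite ?mulr1 ?mulr0.
Qed.

Section MomentFormula.
Variables (R : rcfType) (n : nat) (L : ('M[R]_n -> R) -> R).
Hypothesis HL : is_haar_integral L.
Variables (i0 i1 : 'I_n).

Definition monomial (al be : 'I_n -> nat) (U : 'M[R]_n) : R :=
  \prod_j (U i0 j ^+ al j * U i1 j ^+ be j).

Lemma polyfun_monomial al be : polyfun (monomial al be).
Proof.
by apply: polyfun_prod => j; apply: pf_mul; apply: polyfun_exp; apply: pf_coord.
Qed.

Definition prod_fact (al be : 'I_n -> nat) : R := \prod_j ((al j)`! * (be j)`!)%:R.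

Lemma prod_fact_neq0 al be : prod_fact al be != 0.
Proof. by apply/prodf_neq0 => j _; rewrite natrM mulf_neq0 ?natr_fact_neq0. Qed.

(** The coordinates of both vectors form one family over a sum type, the shape that
    [coefficients_eq] needs. *)
Lemma powmean_expansion d a b (x : 'I_n + 'I_n -> R) : (a < d)%N -> (b < d)%N ->
  powmean L i0 i1 a b (\col_j x (inl j)) (\col_j x (inr j)) =
  \sum_(st : {ffun 'I_n -> 'I_d} * {ffun 'I_n -> 'I_d}
        | (\sum_j st.1 j == a)%N && (\sum_j st.2 j == b)%N)
    ((a`! * b`!)%:R / prod_fact (fun j => st.1 j) (fun j => st.2 j)
      * L (monomial (fun j => st.1 j) (fun j => st.2 j))) *
    \prod_i x i ^+ (match i with inl j => st.1 j | inr j => st.2 j end).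
Proof.
move=> ad bd; pose w (st : {ffun 'I_n -> 'I_d} * {ffun 'I_n -> 'I_d}) :=
  (a`! * b`!)%:R / prod_fact (fun j => st.1 j) (fun j => st.2 j) *
    \prod_i x i ^+ (match i with inl j => st.1 j | inr j => st.2 j end).
transitivity (L (fun U => \sum_(st : {ffun 'I_n -> 'I_d} * {ffun 'I_n -> 'I_d}
        | (\sum_j st.1 j == a)%N && (\sum_j st.2 j == b)%N)
    w st * monomial (fun j => st.1 j) (fun j => st.2 j) U)).
  apply: eq_haar => U.
  rewrite !mxE; under eq_bigr do rewrite mxE.
  under [X in _ * X ^+ _]eq_bigr do rewrite mxE.
  rewrite (multinomial_expansion _ ad) (multinomial_expansion _ bd).
  rewrite mulrACA -natrM big_distrlr /= pair_big /= mulr_sumr.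
  apply: eq_bigr => [[s t]] _ /=.
  rewrite /w /= -!mulrA; congr (_ * _).
  rewrite big_sumType /= /prod_fact /monomial -prodfV -!big_split.
  apply: eq_bigr => j _ /=; rewrite !exprMn natrM; field.
  by rewrite !natr_fact_neq0.
rewrite (haar_sum HL); last first.
  by move=> st; apply: pf_mul; [apply: pf_const | apply: polyfun_monomial].
apply: eq_bigr => st _; rewrite (haarZ HL); last exact: polyfun_monomial.
by rewrite /w mulrAC.
Qed.

(* C k is, up to normalisation, the Weingarten weight common to all pairings
   having 2k pairs that join the two rows; the coefficient counts these pairings
   column by column. *)
Lemma moment_formula A B : (2 <= n)%N -> exists C : nat -> R,
  forall al be : 'I_n -> nat, (\sum_j al j = 2 * A)%N -> (\sum_j be j = 2 * B)%N ->
  L (monomial al be) = prod_fact al be *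
   \sum_(k < (minn A B).+1)
      C k * (\prod_j colpoly R (2 * A + 2 * B).+1 (al j) (be j))`_(2 * k).
Proof.
move=> n2; have [c Hc] := powmean_invariant HL i0 i1 A B n2.
set d := (2 * A + 2 * B).+1.
have Ad : (2 * A < d)%N by rewrite ltnS leq_addr.
have Bd : (2 * B < d)%N by rewrite ltnS leq_addl.
pose N : R := ((2 * A)`! * (2 * B)`!)%:R.
have N0 : N != 0 by rewrite /N natrM mulf_neq0 ?natr_fact_neq0.
(* These factorials come from expanding the powers of the inner products, those in [N] from
   expanding the two linear forms. *)
pose C k := c k * ((A - k)`! * (B - k)`! * (2 * k)`!)%:R.
exists (fun k => C k / N) => al be sal sbe.
have al_d j : (al j < d)%N.
  by apply: leq_ltn_trans Ad; rewrite -sal (bigD1 j) //= leq_addr.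
have be_d j : (be j < d)%N.
  by apply: leq_ltn_trans Bd; rewrite -sbe (bigD1 j) //= leq_addr.
pose T := {ffun 'I_n -> 'I_d * 'I_d * 'I_d}.
pose e (kf : 'I_(minn A B).+1 * T) (i : 'I_n + 'I_n) : nat := match i with
  | inl j => (2 * (kf.2 j).1.1 + (kf.2 j).2)%N
  | inr j => (2 * (kf.2 j).1.2 + (kf.2 j).2)%N end.
pose m (i : 'I_n + 'I_n) : nat := match i with inl j => al j | inr j => be j end.
have kd (k : 'I_(minn A B).+1) : [/\ A - k < d, B - k < d & 2 * k < d]%N.
  have := ltn_ord k; rewrite ltnS leq_min => /andP[kA kB].
  by split; rewrite /d; lia.
have H x : \sum_(st : {ffun 'I_n -> 'I_d} * {ffun 'I_n -> 'I_d}
        | (\sum_j st.1 j == 2 * A)%N && (\sum_j st.2 j == 2 * B)%N)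
    (((2 * A)`! * (2 * B)`!)%:R / prod_fact (fun j => st.1 j) (fun j => st.2 j)
      * L (monomial (fun j => st.1 j) (fun j => st.2 j))) *
    \prod_i x i ^+ (match i with inl j => st.1 j | inr j => st.2 j end) =
  \sum_(kf : 'I_(minn A B).+1 * T | [&& (\sum_j (kf.2 j).1.1 == A - kf.1)%N,
      (\sum_j (kf.2 j).1.2 == B - kf.1)%N & (\sum_j (kf.2 j).2 == 2 * kf.1)%N])
    (C kf.1 * \prod_j ((kf.2 j).1.1`! * (kf.2 j).1.2`! * (kf.2 j).2`!)%:R^-1) *
    \prod_i x i ^+ e kf i.
  rewrite -powmean_expansion // Hc.
  rewrite -(pair_big_dep xpredT (fun (k : 'I_(minn A B).+1) (f : T) =>
     [&& (\sum_j (f j).1.1 == A - k)%N,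
      (\sum_j (f j).1.2 == B - k)%N & (\sum_j (f j).2 == 2 * k)%N])
     (fun (k : 'I_(minn A B).+1) f =>
    (C k * \prod_j ((f j).1.1`! * (f j).1.2`! * (f j).2`!)%:R^-1) *
    \prod_i x i ^+ e (k, f) i)) /=.
  apply: eq_bigr => k _; have [d1 d2 d3] := kd k.
  rewrite (@multinomial_expansion3 _ _ _ _ _ d) // mulrA mulr_sumr.
  apply: eq_bigr => f _; rewrite /C -!mulrA; do 2!congr (_ * _).
  rewrite big_sumType /= -!big_split; apply: eq_bigr => j _ /=.
  have sq (y : R) p r : y ^+ (2 * p + r) = (y * y) ^+ p * y ^+ r.
    by rewrite exprD exprM expr2.
  by rewrite !mxE !sq !exprMn; ring.
have := coefficients_eq H m.
(* On the moment side a single pair of multi-indices, [(s0, t0)], yields the monomial with exponents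
   [al] and [be]. *)
pose s0 : {ffun 'I_n -> 'I_d} := [ffun j => inord (al j)].
pose t0 : {ffun 'I_n -> 'I_d} := [ffun j => inord (be j)].
have s0E j : s0 j = al j :> nat by rewrite ffunE inordK.
have t0E j : t0 j = be j :> nat by rewrite ffunE inordK.
rewrite (big_pred1 (s0, t0)) /=; last first.
  move=> [s t] /=; apply/andP/eqP => [[_ /forallP h]|[-> ->]].
    congr (_, _); apply/ffunP => j; apply: val_inj => /=.
      by rewrite s0E; apply/eqP; apply: (h (inl j)).
    by rewrite t0E; apply/eqP; apply: (h (inr j)).
  split; last by apply/forallP => -[] j; rewrite /= ?s0E ?t0E.
  by rewrite -sal -sbe; apply/andP; split; apply/eqP; apply: eq_bigr => j _.
have -> : (fun j => s0 j : nat) = al by apply: functional_extensionality.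
have -> : (fun j => t0 j : nat) = be by apply: functional_extensionality.
rewrite -/N => E.
have -> : L (monomial al be) = prod_fact al be / N * 
    (N / prod_fact al be * L (monomial al be)).
  by rewrite !mulrA divfK // divff ?prod_fact_neq0 // mul1r.
rewrite {}E -mulrA; congr (_ * _).
rewrite mulr_sumr.
under [RHS]eq_bigr do rewrite coef_prod_colpoly mulr_sumr.
rewrite pair_big_dep /=; apply: eq_big => [[k f]|[k f] _] /=; last by rewrite /C; ring.
have := ltn_ord k; rewrite ltnS leq_min => /andP[kA kB].
apply/andP/andP => [[/and3P[_ _ ->] /forallP h]|[/forallP h /eqP sk]]; split => //.
- by apply/forallP => j; have /= := h (inl j); have /= := h (inr j) => -> ->.
(* Summing the column conditions and halving recovers the two totals that [coef_prod_colpoly] does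
   not mention. *)
- have := sal; have := sbe.
  have -> : (\sum_j al j = 2 * (\sum_j (f j).1.1) + 2 * k)%N.
    rewrite -sk big_distrr -big_split; apply: eq_bigr => j _.
    by case/andP: (h j) => /eqP <-.
  have -> : (\sum_j be j = 2 * (\sum_j (f j).1.2) + 2 * k)%N.
    rewrite -sk big_distrr -big_split; apply: eq_bigr => j _.
    by case/andP: (h j) => _ /eqP <-.
  move=> h2 h1.
  have half u v w : (2 * u + 2 * v = 2 * w)%N -> (u == w - v)%N by lia.
  by rewrite (half _ _ _ h1) (half _ _ _ h2) sk eqxx.
- by apply/forallP => -[] j /=; have /andP[] := h j.
Qed.

End MomentFormula.

(** * Explicit column polynomials *)

(** Even entries force the third component of a triple to be an even number [2 * r], and then the
    other two are [a - r] and [b - r]. *)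
Lemma colpoly_even (R : numFieldType) d D a b :
  (2 * a <= d)%N -> (2 * b <= d)%N -> (minn a b <= D)%N ->
  colpoly R d.+1 (2 * a) (2 * b) =
  \sum_(r : 'I_D.+1 | (r <= minn a b)%N)
     ((2 * r)`! * (a - r)`! * (b - r)`!)%:R^-1 *: 'X^(2 * r).
Proof.
move=> ad bd mD.
pose h (r : 'I_D.+1) : 'I_d.+1 * 'I_d.+1 * 'I_d.+1 :=
  (inord (a - r), inord (b - r), inord (2 * r)).
pose h' (t : 'I_d.+1 * 'I_d.+1 * 'I_d.+1) : 'I_D.+1 := inord (t.2)./2.
have hE (r : 'I_D.+1) : (r <= minn a b)%N ->
    [/\ (h r).1.1 = (a - r)%N :> nat, (h r).1.2 = (b - r)%N :> nat
      & (h r).2 = (2 * r)%N :> nat].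
  by move=> rm; rewrite /h /= !inordK //; lia.
rewrite /colpoly (reindex_onto h h') /=; last first.
  move=> [[p q] r] /= /andP[/eqP pr /eqP qr].
  rewrite /h /h' /=.
  have E : (inord (r./2) : 'I_D.+1) = (r./2) :> nat by rewrite inordK //; lia.
  by congr (_, _, _); apply: val_inj; rewrite /= inordK E //; lia.
have cond (r : 'I_D.+1) : (2 * (h r).1.1 + (h r).2 == 2 * a)%N &&
    (2 * (h r).1.2 + (h r).2 == 2 * b)%N && (h' (h r) == r) = (r <= minn a b)%N.
  apply/idP/idP => [/andP[/andP[/eqP p1 /eqP p2] /eqP p3]|rm].
    (* Beyond [d], [inord] returns its default 0, and the condition on [h'] would then give [r = 0],
       a contradiction. *)
    have rd : (2 * r <= d)%N.
      case: leqP => // dr; have h0 : (h r).2 = 0%N :> nat.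
        by rewrite /h /= /inord /insubd insubF // ltnS leqNgt dr.
      by move: dr; rewrite -p3 /h' h0 /= inordK.
    have ad' : (a - r < d.+1)%N by lia.
    have bd' : (b - r < d.+1)%N by lia.
    by move: p1 p2; rewrite /h /= !inordK //; lia.
  have [e1 e2 e3] := hE r rm.
  have h'r : h' (h r) = r.
    by apply: val_inj; rewrite /h' e3 mul2n doubleK /= inordK.
  by rewrite h'r e1 e2 e3 eqxx andbT; lia.
apply: eq_big => [//|r]; rewrite cond => /hE[e1 e2 e3].
by rewrite e1 e2 e3; congr (_%:R^-1 *: _); lia.
Qed.

Lemma colpoly11 (R : numFieldType) d : colpoly R d.+2 1 1 = 'X.
Proof.
rewrite /colpoly (big_pred1 (ord0, ord0, inord 1)) => [|[[p q] r]] /=.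
  by rewrite inordK // invr1 scale1r.
rewrite !xpair_eqE -!val_eqE /= inordK //; lia.
Qed.

Lemma colpoly_even_min0 (R : numFieldType) d a b : minn a b = 0%N ->
  (2 * a <= d)%N -> (2 * b <= d)%N ->
  colpoly R d.+1 (2 * a) (2 * b) = (a`! * b`!)%:R^-1%:P.
Proof.
move=> ab ad bd; rewrite (@colpoly_even _ _ 0) ?ab // big_mkcond big_ord1 /=.
by rewrite !subn0 mul1n expr0 alg_polyC.
Qed.

(** In the convention used here [dfact (2 * a)] collects the odd factors of the factorial; the even
    ones give the rest. *)
Lemma fact_double_dfact a : ((2 * a)`! = dfact (2 * a) * (2 ^ a * a`!))%N.
Proof.
elim: a => [//|a ih]; have -> : (2 * a.+1 = (2 * a).+2)%N by rewrite mulnS.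
rewrite !factS ih /= expnS; nia.
Qed.

(** * Products over the columns of a two-row matrix *)

Section Columns.
Variables (T : Type) (idx : T).

(** Past the end of the lists [nth] gives the column (0, 0), which is neutral by the hypothesis on
    [F]. *)
Lemma big_nth_narrow (op : Monoid.law idx) n (a b : seq nat) (F : nat -> nat -> T) :
  size a = size b -> (size a <= n)%N -> F 0%N 0%N = idx ->
  \big[op/idx]_(j < n) F (nth 0%N a j) (nth 0%N b j) =
  \big[op/idx]_(j < size a) F (nth 0%N a j) (nth 0%N b j).
Proof.
move=> ab an F0; rewrite -!(big_mkord xpredT (fun j => F (nth 0%N a j) (nth 0%N b j))).
rewrite (@big_cat_nat _ _ _ (size a)) //=.
rewrite [X in op _ X]big1_seq ?Monoid.mulm1 // => j.
rewrite mem_index_iota => /and3P[_ aj _].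
have bj : (size b <= j)%N by rewrite -ab.
by rewrite (nth_default _ aj) (nth_default _ bj).
Qed.

Lemma big_nth_Erow (op : Monoid.law idx) n s x y (F : nat -> nat -> T) :
  (s + x + y <= n)%N -> F 0%N 0%N = idx ->
  \big[op/idx]_(j < n) F (nth 0%N (Erow1 s x y) j) (nth 0%N (Erow2 s x y) j) =
  op (iter s (op (F 1 1)%N) idx)
    (op (iter x (op (F 2 0)%N) idx) (iter y (op (F 0 2)%N) idx)).
Proof.
move=> sn F0; pose ps := nseq s (1, 1)%N ++ nseq x (2, 0)%N ++ nseq y (0, 2)%N.
have E1 : Erow1 s x y = unzip1 ps by rewrite /unzip1 !map_cat !map_nseq.
have E2 : Erow2 s x y = unzip2 ps by rewrite /unzip2 !map_cat !map_nseq.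
have sps : size ps = (s + x + y)%N by rewrite !size_cat !size_nseq addnA.
rewrite E1 E2 big_nth_narrow ?size_map ?sps // -sps.
transitivity (\big[op/idx]_(p <- ps) F p.1 p.2).
  rewrite (big_nth (0, 0)%N) big_mkord; apply: eq_bigr => j _.
  by rewrite !(nth_map (0, 0)%N).
by rewrite !big_cat !big_nseq.
Qed.

End Columns.

Lemma sum_nth n (a : seq nat) : (size a <= n)%N -> (\sum_(j < n) nth 0 a j = sumn a)%N.
Proof.
move=> an; rewrite (@big_nth_narrow _ _ _ n a a (fun x _ => x)) //.
by rewrite sumnE (big_nth 0%N) big_mkord.
Qed.

Lemma sumn_dbl a : sumn (dbl a) = (2 * sumn a)%N.
Proof. by elim: a => //= x a ->; rewrite mulnDr. Qed.

Lemma sumn_Erow1 s x y : sumn (Erow1 s x y) = (s + 2 * x)%N.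
Proof. by rewrite !sumn_cat !sumn_nseq; lia. Qed.

Lemma sumn_Erow2 s x y : sumn (Erow2 s x y) = (s + 2 * y)%N.
Proof. by rewrite !sumn_cat !sumn_nseq; lia. Qed.

Lemma prod_dfact_Erow1 s x y : (\prod_(z <- Erow1 s x y) dfact z = 1)%N.
Proof.
rewrite big1_seq // => z; rewrite !mem_cat !mem_nseq /=.
by case/or3P => /andP[_ /eqP ->].
Qed.

Lemma prod_dfact_Erow2 s x y : (\prod_(z <- Erow2 s x y) dfact z = 1)%N.
Proof.
rewrite big1_seq // => z; rewrite !mem_cat !mem_nseq /=.
by case/or3P => /andP[_ /eqP ->].
Qed.

(** * Evaluation of the two kinds of moments *)

Section Assembly.
Variables (R : rcfType) (n : nat) (L : ('M[R]_n -> R) -> R).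
Hypothesis n2 : (2 <= n)%N.

Let i0 : 'I_n := Ordinal (ltnW n2).
Let i1 : 'I_n := Ordinal n2.

Lemma Imom_monomial a b :
  Imom L a b = L (monomial i0 i1 (fun j => nth 0%N a j) (fun j => nth 0%N b j)).
Proof.
apply: eq_haar => U; rewrite /mono2 /monomial (bigD1 i0) //=.
rewrite [X in _ * X](bigD1 i1) //=.
rewrite [X in _ * (_ * X)]big1 ?mulr1 => [|i /andP[ne0 ne1]].
  by rewrite -big_split.
rewrite big1 // => j _; move: ne0 ne1; rewrite -!val_eqE /=.
by case: (i : nat) => [|[|]].
Qed.

Variables (A B : nat) (C : nat -> R).
Hypothesis HC : forall al be : 'I_n -> nat,
  (\sum_j al j = 2 * A)%N -> (\sum_j be j = 2 * B)%N ->
  L (monomial i0 i1 al be) = prod_fact R al be *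
   \sum_(k < (minn A B).+1)
      C k * (\prod_j colpoly R (2 * A + 2 * B).+1 (al j) (be j))`_(2 * k).

(** A column (1, 1) contributes the variable, and columns (2, 0) and (0, 2) contribute 1, so the
    product is a pure power that selects [C k]. The [A + B] columns fit because [A + B <= n]; each
    entry 2 brings a factor 2!. *)
Lemma Imom_E k : (k <= minn A B)%N -> (A + B <= n)%N ->
  Imom L (Erow1 (2 * k) (A - k) (B - k)) (Erow2 (2 * k) (A - k) (B - k)) =
  (2 ^ (A - k) * 2 ^ (B - k))%:R * C k.
Proof.
move=> kAB ABn.
have szn : (2 * k + (A - k) + (B - k) <= n)%N by lia.
have sz1 : (size (Erow1 (2 * k) (A - k) (B - k)) <= n)%N.
  by rewrite !size_cat !size_nseq addnA.
have sz2 : (size (Erow2 (2 * k) (A - k) (B - k)) <= n)%N.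
  by rewrite !size_cat !size_nseq addnA.
rewrite Imom_monomial HC; last 2 first.
- by rewrite sum_nth // sumn_Erow1; lia.
- by rewrite sum_nth // sumn_Erow2; lia.
have -> : prod_fact R (fun j : 'I_n => nth 0%N (Erow1 (2 * k) (A - k) (B - k)) j)
   (fun j => nth 0%N (Erow2 (2 * k) (A - k) (B - k)) j) =
   (2 ^ (A - k) * 2 ^ (B - k))%:R.
  rewrite /prod_fact (@big_nth_Erow _ _ _ n _ _ _ (fun x y => (x`! * y`!)%:R)) //=.
  by rewrite !iter_mulr_1 expr1n mul1r !natrM !natrX !mulr1.
congr (_ * _).
have -> : \prod_(j < n) colpoly R (2 * A + 2 * B).+1
    (nth 0%N (Erow1 (2 * k) (A - k) (B - k)) j)
    (nth 0%N (Erow2 (2 * k) (A - k) (B - k)) j) = 'X^(2 * k).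
  rewrite (@big_nth_Erow _ _ _ n _ _ _ (colpoly R (2 * A + 2 * B).+1)) //=; last first.
    by rewrite (@colpoly_even_min0 _ _ 0 0) // invr1.
  (* The bound [2 * A + 2 * B] must reach 2 for the column lemmas; otherwise the matrix has no
     columns. *)
  have [AB0|AB0] := posnP (A + B).
    have [-> -> ->] : [/\ A = 0, B = 0 & k = 0]%N by split; lia.
    by rewrite /= !mulr1.
  rewrite (@colpoly_even_min0 _ _ 1 0) //; try lia.
  rewrite (@colpoly_even_min0 _ _ 0 1) //; try lia.
  rewrite !invr1 polyC1 !iter_mulr_1 !expr1n !mulr1.
  have [d ->] : exists d, (2 * A + 2 * B = d.+1)%N.
    by exists (2 * A + 2 * B).-1; lia.
  by rewrite colpoly11.
rewrite (bigD1 (Ordinal (kAB : k < (minn A B).+1)%N)) //= coefXn eqxx mulr1.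
rewrite big1 ?addr0 // => i; rewrite -val_eqE /= => ik.
by rewrite coefXn eqn_pmul2l // (negPf ik) mulr0.
Qed.

Lemma nth_leq_sumn (a : seq nat) j : (nth 0 a j <= sumn a)%N.
Proof.
elim: a j => [|x a ih] [|j] //=; first exact: leq_addr.
exact: leq_trans (ih j) (leq_addl _ _).
Qed.

Lemma nth_dbl (a : seq nat) j : nth 0%N (dbl a) j = (2 * nth 0 a j)%N.
Proof.
have [ja|aj] := ltnP j (size a); first by rewrite (nth_map 0%N).
by rewrite !nth_default ?size_map.
Qed.

Section Dbl.
Variables a b : seq nat.
Hypotheses (aA : sumn a = A) (bB : sumn b = B).
Hypotheses (ab : size a = size b) (an : (size a <= n)%N).

Lemma sum_leq_minn (f : 'I_(size a) -> nat) :
  (forall i, f i <= minn (nth 0 a i) (nth 0 b i))%N -> (\sum_i f i <= minn A B)%N.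
Proof.
move=> fm; rewrite leq_min -aA -bB -(sum_nth (leqnn (size a))).
rewrite -(@sum_nth (size a) b) ?ab //.
by apply/andP; split; apply: leq_sum => i _; have := fm i; rewrite leq_min => /andP[].
Qed.

(** Distributing the product of the [colpoly_even] sums chooses one [f j] per column; the total
    exponent is twice the sum of the [f j], which picks the index of [C]. *)
Lemma Imom_dbl : Imom L (dbl a) (dbl b) =
  \prod_(j < size a) ((2 * nth 0 a j)`! * (2 * nth 0 b j)`!)%:R *
  \sum_(f : {ffun 'I_(size a) -> 'I_A.+1}
      | [forall i, (f i <= minn (nth 0 a i) (nth 0 b i))%N])
   \prod_(j < size a)
     ((2 * f j)`! * (nth 0 a j - f j)`! * (nth 0 b j - f j)`!)%:R^-1
   * C (\sum_(j < size a) f j)%N.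
Proof.
have bn : (size b <= n)%N by rewrite -ab.
rewrite Imom_monomial HC; last 2 first.
- by rewrite sum_nth ?sumn_dbl ?size_map ?aA.
- by rewrite sum_nth ?sumn_dbl ?size_map ?bB.
rewrite /prod_fact; under eq_bigr do rewrite !nth_dbl.
rewrite (@big_nth_narrow _ _ _ n a b (fun x y => ((2 * x)`! * (2 * y)`!)%:R)) //.
congr (_ * _).
have -> : \prod_(j < n) colpoly R (2 * A + 2 * B).+1
    (nth 0%N (dbl a) j) (nth 0%N (dbl b) j) =
  \sum_(f : {ffun 'I_(size a) -> 'I_A.+1}
      | [forall i, (f i <= minn (nth 0 a i) (nth 0 b i))%N])
   (\prod_(j < size a)
     ((2 * f j)`! * (nth 0 a j - f j)`! * (nth 0 b j - f j)`!)%:R^-1)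
   *: 'X^(2 * \sum_(j < size a) f j).
  under eq_bigr do rewrite !nth_dbl.
  rewrite (@big_nth_narrow _ _ _ n a b
    (fun x y => colpoly R (2 * A + 2 * B).+1 (2 * x) (2 * y))) //; last first.
    by rewrite (@colpoly_even_min0 _ _ 0 0) // invr1.
  have aj j : (nth 0 a j <= A)%N by rewrite -aA nth_leq_sumn.
  have bj j : (nth 0 b j <= B)%N by rewrite -bB nth_leq_sumn.
  under eq_bigr => j _.
    rewrite (@colpoly_even _ _ A); last 3 first.
    - by have := aj j; lia.
    - by have := bj j; lia.
    - by have := aj j; lia.
    over.
  rewrite bigA_distr_big_dep; apply: eq_big => [f|f _].
    by apply/familyP/forallP.
  by rewrite scaler_prod prodrXr big_distrr.
under eq_bigr do rewrite coef_sum mulr_sumr.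
rewrite exchange_big; apply: eq_bigr => f /forallP fm /=.
have RAB : (\sum_(j < size a) f j < (minn A B).+1)%N.
  by rewrite ltnS; apply: sum_leq_minn.
rewrite (bigD1 (Ordinal RAB)) //= coefZ coefXn eqxx mulr1.
rewrite [X in _ + X]big1 ?addr0 => [|i]; first by rewrite mulrC.
rewrite -val_eqE /= => iR.
by rewrite coefZ coefXn eqn_pmul2l // (negPf iR) !mulr0.
Qed.

End Dbl.
End Assembly.

(** * Double factorial normalisation and conclusion *)

Lemma prod_dfact_dbl a :
  (\prod_(x <- dbl a) dfact x = \prod_(j < size a) dfact (2 * nth 0 a j))%N.
Proof. by rewrite big_map (big_nth 0%N) big_mkord. Qed.

Lemma dfact_gt0 m : (0 < dfact m)%N.
Proof.
suff : (0 < dfact m)%N && (0 < dfact m.+1)%N by case/andP.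
by elim: m => [//|m /andP[h1 h2]]; rewrite h2 /= muln_gt0 h1.
Qed.

(** The share of one column in the final comparison of constants: split both factorials by
    [fact_double_dfact] and take [2 ^ r] out of each power of 2. *)
Lemma column_weight a b r : (r <= a)%N -> (r <= b)%N ->
  ((2 * a)`! * (2 * b)`! = 4 ^ r * a`! * b`! * (2 ^ (a - r) * 2 ^ (b - r))
     * (dfact (2 * a) * dfact (2 * b)))%N.
Proof.
move=> ra rb; have split2 c : (r <= c -> 2 ^ c = 2 ^ (c - r) * 2 ^ r)%N.
  by move=> rc; rewrite -expnD subnK.
by rewrite !fact_double_dfact (split2 a) // (split2 b) // (expnMn 2 2); ring.
Qed.

Theorem theorem3p3 (R : rcfType) (n : nat) (L : ('M[R]_n -> R) -> R)
    (HL : is_haar_integral L) (a b : seq nat)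
    (Hab : size a = size b) (Hn2 : (2 <= n)%N) (Hqn : (size a <= n)%N)
    (HnAB : (sumn a + sumn b <= n)%N) :
  Phi L (dbl a) (dbl b) =
  \sum_(r : {ffun 'I_(size a) -> 'I_(sumn a).+1}
          | [forall i, (val (r i) <= minn (nth 0 a i) (nth 0 b i))%N])
     (\prod_(i < size a)
        ((4 ^ val (r i) * (nth 0 a i)`! * (nth 0 b i)`!)%:R /
         ((2 * val (r i))`! * (nth 0 a i - val (r i))`!
            * (nth 0 b i - val (r i))`!)%:R))
     * Phi L (Erow1 (2 * \sum_(i < size a) val (r i))
                    (sumn a - \sum_(i < size a) val (r i))
                    (sumn b - \sum_(i < size a) val (r i)))
             (Erow2 (2 * \sum_(i < size a) val (r i))
                    (sumn a - \sum_(i < size a) val (r i))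
                    (sumn b - \sum_(i < size a) val (r i))).
Proof.
have [C HC] := moment_formula HL (Ordinal (ltnW Hn2)) (Ordinal Hn2) (sumn a) (sumn b) Hn2.
rewrite /Phi (Imom_dbl HC erefl erefl Hab Hqn) !mulr_sumr !sumn_dbl.
apply: eq_bigr => r /forallP rm.
have RAB := sum_leq_minn erefl erefl Hab rm.
set k := (\sum_(i < size a) r i)%N in RAB *.
have := RAB; rewrite leq_min => /andP[kA kB].
rewrite (Imom_E HC) // prod_dfact_Erow1 prod_dfact_Erow2 sumn_Erow1 sumn_Erow2.
(* The rows of the E matrix sum to [2 * sumn a] and [2 * sumn b], so both sides carry the same
   double factorials of row sums. *)
rewrite -!mulnDr !subnKC // !muln1 !prod_dfact_dbl -Hab.
set W := \prod_(j < size a) _^-1; set F := \prod_(j < size a) _%:R.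
set Q := \prod_(i < size a) (_ / _); set p := (_ * _)%:R.
(* The powers of 2 are those of [Imom_E]. Once they are spread over the columns, the identity is
   [column_weight] in each factor. *)
have key : F * W = Q * (2 ^ (sumn a - k) * 2 ^ (sumn b - k))%:R *
  ((\prod_(j < size a) dfact (2 * nth 0 a j)) *
   (\prod_(j < size a) dfact (2 * nth 0 b j)))%:R.
  have -> : (sumn a - k = \sum_(i < size a) (nth 0 a i - r i))%N.
    rewrite sumnB => [|i _]; first by rewrite (sum_nth (leqnn _)).
    by have := rm i; rewrite leq_min => /andP[].
  have -> : (sumn b - k = \sum_(i < size a) (nth 0 b i - r i))%N.
    rewrite sumnB => [|i _]; first by rewrite (@sum_nth _ b) ?Hab.
    by have := rm i; rewrite leq_min => /andP[].
  rewrite !expn_sum -!big_split /= natr_prod natr_prod -!big_split /=.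
  apply: eq_bigr => i _.
  have := rm i; rewrite leq_min => /andP[ra rb].
  rewrite (column_weight ra rb) [in LHS]natrM [in LHS]natrM -!mulrA; congr (_ * _).
  by rewrite [RHS]mulrC -!mulrA; congr (_ * _).
set S := (\prod_(j < size a) dfact (2 * nth 0 a j))%N in key *.
set T := (\prod_(j < size a) dfact (2 * nth 0 b j))%N in key *.
have nz m : (0 < m)%N -> m%:R != 0 :> R by rewrite pnatr_eq0 -lt0n.
have D0 := nz _ (dfact_gt0 (n - 2)).
have S0 : S%:R != 0 :> R by apply: nz; apply: prodn_gt0 => j; apply: dfact_gt0.
have T0 : T%:R != 0 :> R by apply: nz; apply: prodn_gt0 => j; apply: dfact_gt0.
rewrite (mulrA F) key !(natrM, natrX); field.
by rewrite D0 S0 T0.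
Qed.
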